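(* Let $C\subseteq\mathbb{R}^d$ be nonempty, closed and convex, let $z\in\mathbb{R}^d$, $B\in\mathbb{R}^{n\times d}$, let $\varphi\in\mathrm{SPF}(\mathbb{R}^n)$ be convex, and let $\lambda,\alpha>0$. Set $$Q(x)=\frac{1}{2\lambda}\|x-z\|^2+\iota_C(x)+\varphi(Bx),\qquad P(x)=\mathrm{env}_\alpha\varphi(Bx),\qquad x\in\mathbb{R}^d,$$ and consider the problem $\min\{Q(x)-P(x):x\in\mathbb{R}^d\}$. Suppose that, starting from some $x^{(0)}\in\mathrm{dom}\,\partial P$, the sequences $\{x^{(k)}\}_{k\in\mathbb{N}}$ and $\{y^{(k)}\}_{k\in\mathbb{N}}$ are generated for $k=0,1,2,\dots$ by $$y^{(k)}=B^\top\nabla\mathrm{env}_\alpha\varphi(Bx^{(k)}),$$ $$x^{(k+1)}=\operatorname{argmin}\left\{\frac{1}{2\lambda}\|x-z\|^2+\iota_C(x)+\varphi(Bx)-\langle y^{(k)},x\rangle:x\in\mathbb{R}^d\right\}.$$ Then every limit point $x^\diamond$ of $\{x^{(k)}\}_{k\in\mathbb{N}}$ is a critical point of the problem, i.e. $0\in\partial(Q-P)(x^\diamond)$. Moreover, $\lim_{k\to\infty}\|x^{(k+1)}-x^{(k)}\|=0$.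
   Context: $\|\cdot\|$ is the Euclidean norm. $\iota_C$ is the indicator function of $C$ ($0$ on $C$, $+\infty$ off $C$). $\Gamma(\mathbb{R}^n)$ is the set of proper lower semicontinuous functions $\mathbb{R}^n\to\mathbb{R}\cup\{+\infty\}$. The Fréchet subdifferential of $p$ at $z$ is $\partial p(z)=\{t:\liminf_{u\to z}\frac{p(u)-p(z)-\langle t,u-z\rangle}{\|u-z\|}\ge 0\}$; for convex $p$ it is the usual convex subdifferential. $\mathrm{dom}\,\partial P$ is the set of points where $\partial P$ is nonempty. A point $x$ is a critical point of $p$ if $0\in\partial p(x)$. A function $\varphi\in\Gamma(\mathbb{R}^n)$ is sparsity promoting, written $\varphi\in\mathrm{SPF}(\mathbb{R}^n)$, if (a) $\varphi$ achieves its global minimum, equal to zero, at the origin, and (b) $\partial\varphi(0)$ contains a nonzero element. For $\alpha>0$, the Moreau envelope of $\varphi$ is $\mathrm{env}_\alpha\varphi(u)=\min\{\varphi(w)+\frac{1}{2\alpha}\|w-u\|^2: w\in\mathbb{R}^n\}$; for convex $\varphi$ it is a differentiable convex function. *)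

(* Defs.v *)
From HB Require Import structures.
From mathcomp Require Import all_boot all_order all_algebra.
From mathcomp Require Import all_classical all_reals all_analysis.

Set Implicit Arguments.
Unset Strict Implicit.
Unset Printing Implicit Defensive.

Import Order.TTheory GRing.Theory Num.Theory.
Import numFieldNormedType.Exports.

Local Open Scope classical_set_scope.
Local Open Scope ring_scope.

Section euclidean.
Context {R : realType} {n : nat}.
Implicit Types u v : 'cV[R]_n.

Definition dotv u v : R := \sum_i u i ord0 * v i ord0.

(* The library norm `|u| on matrices is the sup norm; it induces the same
   topology as enorm. *)
Definition enorm u : R := Num.sqrt (dotv u u).

Definition gradient (f : 'cV[R]_n -> R) u : 'cV[R]_n :=
  \col_i 'D_(delta_mx i ord0) f u.

End euclidean.

Section extended_valued_functions.
Context {R : realType} {n : nat}.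
Implicit Types (p phi : 'cV[R]_n -> \bar R) (u z t : 'cV[R]_n).
Local Open Scope ereal_scope.

Definition indicatorf (C : set 'cV[R]_n) u : \bar R :=
  if u \in C then 0 else +oo.

Definition proper p :=
  (forall u, p u != -oo) /\ (exists u, p u \is a fin_num).

Definition Gamma p := proper p /\ lower_semicontinuous p.

(* In \bar R, 0 * +oo = 0, so the endpoints s = 0 and s = 1 are harmless. *)
Definition convex_efun p := forall u v (s : R), (0 <= s <= 1)%R ->
  p (s *: u + (1 - s) *: v)%R <= s%:E * p u + (1 - s)%:E * p v.

(* As usual, the subdifferential is empty where p is not finite. *)
Definition subdiff p z : set 'cV[R]_n := [set t |
  p z \is a fin_num /\
  0 <= limf_einf
         (fun u => (p u - p z - (dotv t (u - z))%:E) * ((enorm (u - z))^-1)%:E)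
         z^'].

Definition dom_subdiff p : set 'cV[R]_n := [set z | subdiff p z !=set0].

Definition critical_point p z := subdiff p z 0%R.

Definition SPF phi :=
  [/\ Gamma phi,
      phi 0%R = 0 /\ (forall u, 0 <= phi u) &
      exists2 t, subdiff phi 0%R t & t != 0%R].

Definition moreau_env (alpha : R) phi u : \bar R :=
  ereal_inf (range (fun w =>
    phi w + ((2 * alpha)^-1 * enorm (w - u) ^+ 2)%:E)).

(* The argmin of the constant function +oo is empty. *)
Definition argmin p : set 'cV[R]_n :=
  [set u | p u < +oo /\ forall w, p u <= p w].

End extended_valued_functions.

(* Main.v *)
Require Import Defs.
From HB Require Import structures.
From mathcomp Require Import all_boot all_order all_algebra.
From mathcomp Require Import all_classical all_reals all_analysis.
From mathcomp Require Import ring lra.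

Set Implicit Arguments.
Unset Strict Implicit.
Unset Printing Implicit Defensive.

Import Order.TTheory GRing.Theory Num.Theory.
Import numFieldNormedType.Exports.

Local Open Scope classical_set_scope.
Local Open Scope ring_scope.

(* The proximal point of u exists (a minimizing sequence of a strongly convex
   function is Cauchy) and gives a slope g with
     E u + <g, v - u> <= E v <= E u + <g, v - u> + |v - u|^2 / (2 alpha)
   for E = env_alpha phi, so that g is the gradient of E at u. With F = Q - P,
   the lower bound and the strong convexity of Q give the descent
     F (x (k+1)) + |x (k+1) - x k|^2 / (2 lambda) <= F (x k),
   and F >= 0 because E <= phi; hence the steps tend to 0. Both bounds together
   give F (x (k+1)) - K |w - x k|^2 <= F w for all w, where K depends only on
   alpha and B. Since F is lower semicontinuous, this passes to a limit point xd
   as F xd - K |w - xd|^2 <= F w, which makes xd critical; no continuity of the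
   gradient is needed. *)

(** * Inner product algebra and its link with the topology of column vectors *)

Section dot_product.
Context {R : realType} {n : nat}.
Implicit Types (u v w : 'cV[R]_n) (a : R).

Lemma dotvC u v : dotv u v = dotv v u.
Proof. by apply: eq_bigr => i _; rewrite mulrC. Qed.

Lemma dotvDl u v w : dotv (u + v) w = dotv u w + dotv v w.
Proof. by rewrite -big_split; apply: eq_bigr => i _; rewrite mxE mulrDl. Qed.

Lemma dotvZl a u v : dotv (a *: u) v = a * dotv u v.
Proof. by rewrite mulr_sumr; apply: eq_bigr => i _; rewrite mxE mulrA. Qed.

Lemma dotvNl u v : dotv (- u) v = - dotv u v.
Proof. by rewrite -scaleN1r dotvZl mulN1r. Qed.

Lemma dotvDr u v w : dotv u (v + w) = dotv u v + dotv u w.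
Proof. by rewrite dotvC dotvDl !(dotvC _ u). Qed.

Lemma dotvZr a u v : dotv u (a *: v) = a * dotv u v.
Proof. by rewrite dotvC dotvZl dotvC. Qed.

Lemma dotvNr u v : dotv u (- v) = - dotv u v.
Proof. by rewrite dotvC dotvNl dotvC. Qed.

Definition dotvE := (dotvDl, dotvDr, dotvNl, dotvNr, dotvZl, dotvZr).

Lemma dotv0l u : dotv 0 u = 0.
Proof. by rewrite -(scale0r u) dotvZl mul0r. Qed.

Lemma dotv_ge0 u : 0 <= dotv u u.
Proof. by apply: sumr_ge0 => i _; rewrite -expr2 sqr_ge0. Qed.

Lemma enorm_sqr u : enorm u ^+ 2 = dotv u u.
Proof. exact/sqr_sqrtr/dotv_ge0. Qed.

Lemma coord_sqr_le_dotv u i : u i ord0 ^+ 2 <= dotv u u.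
Proof.
rewrite /dotv (bigD1 i) //= -expr2 lerDl.
by apply: sumr_ge0 => j _; rewrite -expr2 sqr_ge0.
Qed.

Lemma dotv_eq0 u : dotv u u = 0 -> u = 0.
Proof.
move=> u0; apply/colP => i; rewrite mxE; apply/eqP.
by rewrite -sqrf_eq0 eq_le sqr_ge0 andbT -u0 coord_sqr_le_dotv.
Qed.

(** The squared norm of [dotv v v *: u - dotv u v *: v] is [dotv v v] times the gap between the two
    sides. *)
Lemma dotv_CS u v : dotv u v ^+ 2 <= dotv u u * dotv v v.
Proof.
have [v0|v_gt0] := leP (dotv v v) 0.
  have /dotv_eq0 -> : dotv v v = 0 by apply/eqP; rewrite eq_le v0 dotv_ge0.
  by rewrite dotvC !dotv0l mulr0 expr0n.
have := dotv_ge0 (dotv v v *: u - dotv u v *: v).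
rewrite !dotvE (dotvC v u).
set a := dotv u u; set b := dotv v v; set c := dotv u v => h.
by rewrite -subr_ge0 -(pmulr_rge0 _ v_gt0) -/b; nra.
Qed.

Lemma dotv_delta u i : dotv u (delta_mx i ord0) = u i ord0.
Proof.
rewrite /dotv (bigD1 i) //= big1 => [|j /negPf ji].
  by rewrite mxE !eqxx mulr1 addr0.
by rewrite mxE ji mulr0.
Qed.

(** Bridge from Euclidean estimates to [ball], which is taken coordinatewise. *)
Lemma dotv_lt_ball u v e : 0 < e -> dotv (u - v) (u - v) < e ^+ 2 -> ball u e v.
Proof.
move=> e0 uve; split => // i j; rewrite (ord1 j) /ball /=.
have := le_lt_trans (coord_sqr_le_dotv (u - v) i) uve.
by rewrite !mxE -real_normK ?num_real// ltr_pXn2r// nnegrE ltW.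
Qed.

Lemma cvg_dotv (T : Type) (F : set_system T) (FF : Filter F)
    (f g : T -> 'cV[R]_n) u v :
  f @ F --> u -> g @ F --> v -> dotv (f t) (g t) @[t --> F] --> dotv u v.
Proof.
move=> fu gv; apply: cvg_big => [|i _]; first exact: add_continuous.
apply: cvgM.
  exact: (cvg_comp _ _ fu (@coord_continuous _ _ _ i ord0 u)).
exact: (cvg_comp _ _ gv (@coord_continuous _ _ _ i ord0 v)).
Qed.

Lemma cvg_dotvB w u : dotv (v - w) (v - w) @[v --> u] --> dotv (u - w) (u - w).
Proof.
have FF := nbhs_filter u.
have vw : (v - w) @[v --> u] --> u - w.
  by apply: cvgB; [exact: cvg_id | exact: cvg_cst].
exact: cvg_dotv.
Qed.

Lemma cvg_enormB u : enorm (v - u) @[v --> u] --> 0.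
Proof.
have := cvg_comp _ _ (@cvg_dotvB u u) (@sqrt_continuous R _).
by rewrite subrr dotv0l sqrtr0.
Qed.

End dot_product.

(** * Adjoint, boundedness and continuity of a matrix *)

Section matrix_action.
Context {R : realType} {d n : nat}.
Variable B : 'M[R]_(n, d).

Lemma dotv_mulmx u w : dotv (B^T *m u) w = dotv u (B *m w).
Proof.
have dE m (a b : 'cV[R]_m) : dotv a b = (a^T *m b) ord0 ord0.
  by rewrite mxE; apply: eq_bigr => i _; rewrite mxE.
by rewrite !dE trmx_mul trmxK mulmxA.
Qed.

(** Cauchy-Schwarz on each row; the constant is the squared Frobenius norm of [B]. *)
Lemma dotv_mulmx_le : exists2 K, 0 <= K &
  forall v, dotv (B *m v) (B *m v) <= K * dotv v v.
Proof.
pose r i := (row i B)^T.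
exists (\sum_i dotv (r i) (r i)) => [|v].
  by apply: sumr_ge0 => i _; exact: dotv_ge0.
rewrite mulr_suml; apply: ler_sum => i _; rewrite -expr2.
have -> : (B *m v) i ord0 = dotv (r i) v.
  by rewrite mxE; apply: eq_bigr => j _; rewrite !mxE.
exact: dotv_CS.
Qed.

Lemma continuous_mulmx_cV : continuous (fun v : 'cV[R]_d => B *m v).
Proof.
move=> v; have [K K0 BK] := dotv_mulmx_le; have FF := nbhs_filter v.
move=> V /nbhs_ballP[e e0 eV]; rewrite nbhs_simpl /=.
have := @cvg_dotvB R d v v; rewrite subrr dotv0l.
move=> /cvgr0Pnorm_lt /(_ (e ^+ 2 / (K + 1))).
have K1 : 0 < K + 1 by lra.
rewrite divr_gt0 ?exprn_gt0// => /(_ isT); apply: filterS => w.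
rewrite ger0_norm ?dotv_ge0// ltr_pdivlMr// => h.
apply/eV/dotv_lt_ball => //; rewrite -mulmxBr -opprB mulmxN !dotvE opprK.
apply: le_lt_trans (BK _) (le_lt_trans _ h).
by rewrite mulrC ler_wpM2l ?dotv_ge0//; lra.
Qed.

End matrix_action.

(** Lower semicontinuity is applied at the threshold [m + e], so that approximation errors adding up
    to less than [e] still give a contradiction. *)
Lemma lte_EFin_slack (R : realType) (m : R) (y : \bar R) : (m%:E < y)%E ->
  exists2 e, 0 < e & ((m + e)%:E < y)%E.
Proof.
case: y => [r||//]; last by exists 1 => //; exact: ltry.
by rewrite lte_fin => mr; exists ((r - m) / 2); rewrite ?lte_fin; lra.
Qed.

(** * Existence and strong minimality of proximal points *)

Section proximal_minimizer.
Context {R : realType} {n : nat}.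
Implicit Types (S : 'cV[R]_n -> R -> Prop) (u v w : 'cV[R]_n) (c : R).

(* [S w a] reads "[a] bounds the value at [w]": convexity of the epigraph. *)
Definition convex_epi S := forall u v a b (s : R), 0 <= s <= 1 ->
  S u a -> S v b -> S (s *: u + (1 - s) *: v) (s * a + (1 - s) * b).

Lemma convex_efun_epi (p : 'cV[R]_n -> \bar R) :
  convex_efun p -> convex_epi (fun w a => (p w <= a%:E)%E).
Proof.
move=> cp u v a b s /andP[s0 s1] ua vb.
apply: le_trans (cp _ _ _ _) _; first by rewrite s0.
rewrite (EFinD (s * a)) !EFinM; apply: leeD; apply: lee_wpmul2l => //.
by rewrite lee_fin subr_ge0.
Qed.

(** Minimality tested at [w + s (v - w)], divided by [s], gives the first-order inequality [slope]
    as [s] tends to 0; expanding the square around [w] turns it into the claim. *)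
Lemma proximal_min_strong S c u w a : 0 <= c -> convex_epi S -> S w a ->
  (forall v b, S v b ->
    a + c * dotv (w - u) (w - u) <= b + c * dotv (v - u) (v - u)) ->
  forall v b, S v b ->
    a + c * dotv (w - u) (w - u) + c * dotv (v - w) (v - w) <=
    b + c * dotv (v - u) (v - u).
Proof.
move=> c0 cS Sw wmin v b Sv.
suff slope : a - b <= 2 * c * dotv (w - u) (v - w).
  have -> : v - u = (w - u) + (v - w) by apply/colP => i; rewrite !mxE; ring.
  move: slope; move: (w - u) (v - w) => x y; rewrite !dotvE (dotvC y x).
  by move: (dotv x x) (dotv x y) (dotv y y) => xx xy yy; nra.
set k := c * dotv (v - w) (v - w).
have k0 : 0 <= k by rewrite mulr_ge0 ?dotv_ge0.
apply/ler_addgt0Pr => e e0.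
(* Keeps [s] in (0, 1] and the second-order term [s * k] at most [e]; the [+ 1] covers [k = 0]. *)
pose s := Num.min 1 (e / (k + 1)).
have k1 : 0 < k + 1 by lra.
have s0 : 0 < s by rewrite lt_min ltr01 divr_gt0.
have s1 : s <= 1 by rewrite ge_min lexx.
have ske : s * k <= e.
  apply: (@le_trans _ _ (s * (k + 1))); first by rewrite ler_wpM2l ?ltW//; lra.
  by rewrite -ler_pdivlMr// ge_min lexx orbT.
have s01 : 0 <= s <= 1 by rewrite s1 ltW.
have := wmin _ _ (cS _ _ _ _ _ s01 Sv Sw).
have -> : s *: v + (1 - s) *: w - u = (w - u) + s *: (v - w).
  by rewrite scalerBl scalerBr scale1r; apply/colP => i; rewrite !mxE; ring.
move: ske; rewrite /k; move: (w - u) (v - w) => x y.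
rewrite !dotvE (dotvC y x) -(ler_pM2l s0).
by move: (dotv x x) (dotv x y) (dotv y y) => xx xy yy; nra.
Qed.

Lemma proximal_min_ex (p : 'cV[R]_n -> \bar R) c u : 0 < c ->
  (forall v, 0 <= p v)%E -> (exists v, p v \is a fin_num) ->
  convex_efun p -> lower_semicontinuous p ->
  exists w a, p w = a%:E /\ forall v b, (p v <= b%:E)%E ->
    a + c * dotv (w - u) (w - u) <= b + c * dotv (v - u) (v - u).
Proof.
move=> c0 p0 [v0 pv0] /convex_efun_epi cp lscp.
(* Real upper bounds stand in for the extended values, so the infimum is taken in [R]. *)
pose V := [set r | exists v b, (p v <= b%:E)%E /\
  r = b + c * dotv (v - u) (v - u)].
have Vlb : lbound V 0.
  move=> _ [v [b [pvb ->]]]; rewrite addr_ge0 ?mulr_ge0 ?dotv_ge0 ?(ltW c0)//.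
  by rewrite -lee_fin; exact: le_trans pvb.
have Vinf : has_inf V.
  by split; [eexists; exists v0, (fine (p v0)); rewrite fineK|exists 0].
pose m := inf V.
have mV v b : (p v <= b%:E)%E -> m <= b + c * dotv (v - u) (v - u).
  by move=> pvb; apply: ge_inf; [exact: Vinf.2 | exists v, b].
have /choice[w wP] k : exists w : 'cV[R]_n, exists2 b, (p w <= b%:E)%E &
    b + c * dotv (w - u) (w - u) < m + k.+1%:R^-1.
  have [|_ [w [b [pwb ->]]] h] := @inf_adherent _ V (k.+1%:R^-1) _ Vinf.
    by rewrite invr_gt0 ltr0n.
  by exists w, b.
(* The midpoint of [w k] and [w l] has objective at least [m]; the parallelogram identity turns the
   two optimality gaps into a bound on the distance. *)
have w_close k l :
    c * dotv (w k - w l) (w k - w l) <= 2 * (k.+1%:R^-1 + l.+1%:R^-1).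
  have [a pa ha] := wP k; have [b pb hb] := wP l.
  have half : 0 <= (1 / 2 : R) <= 1 by lra.
  have := mV _ _ (cp _ _ _ _ _ half pa pb).
  have -> : (1 / 2) *: w k + (1 - 1 / 2) *: w l - u =
      (1 / 2) *: ((w k - u) + (w l - u)).
    by apply/colP => i; rewrite !mxE; field.
  have -> : w k - w l = (w k - u) - (w l - u).
    by rewrite opprB addrA subrK.
  move: ha hb; move: (w k - u) (w l - u) (k.+1%:R^-1) (l.+1%:R^-1).
  move=> x y dk dl; rewrite !dotvE (dotvC y x).
  by move: (dotv x x) (dotv x y) (dotv y y) => xx xy yy; nra.
have /cvg_ex[x wx] : cvg (w @ \oo).
  apply/cauchy_cvgP/cauchyP => e e0.
  have [K _ Ksmall] : \forall k \near \oo, @harmonic R k < c * e ^+ 2 / 4.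
    apply: cvgr_lt cvg_harmonic _ _.
    by rewrite divr_gt0 ?mulr_gt0 ?exprn_gt0.
  exists (w K); exists K => // k /= Kk; apply: dotv_lt_ball => //.
  rewrite -(ltr_pM2l c0); apply: le_lt_trans (w_close K k) _.
  have := Ksmall _ Kk; have := Ksmall _ (leqnn K).
  rewrite /harmonic /=.
  by move: (K.+1%:R^-1) (k.+1%:R^-1) (c * e ^+ 2) => x y z; lra.
have quad_cvg : c * dotv (w k - u) (w k - u) @[k --> \oo] -->
    c * dotv (x - u) (x - u).
  apply: cvgMr; apply: cvg_dotv; apply: cvgB => //; exact: cvg_cst.
(* Otherwise lower semicontinuity at [x] with slack [e] contradicts near-optimality of [w k]: half
   of [e] absorbs the quadratic term, half the gap [k.+1%:R^-1]. *)
have px : (p x <= (m - c * dotv (x - u) (x - u))%:E)%E.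
  rewrite leNgt; apply/negP => lt_px.
  have [e e0 /lscp[W xW Wlt]] := lte_EFin_slack lt_px.
  have e2 : 0 < e / 2 by lra.
  near \oo => k.
  have [b pb hb] := wP k.
  have := lt_le_trans (Wlt (w k) _) pb; rewrite lte_fin.
  have : k.+1%:R^-1 < e / 2.
    by near: k; exact: (cvgr_lt _ (@cvg_harmonic R)).
  have : c * dotv (x - u) (x - u) - e / 2 < c * dotv (w k - u) (w k - u).
    by near: k; apply: (cvgr_gt _ quad_cvg); lra.
  have Wk : W (w k) by near: k; exact: wx.
  by move: hb; move: (k.+1%:R^-1) => z hb h1 h2 /(_ Wk); lra.
have pxfin : p x \is a fin_num.
  by rewrite ge0_fin_numE// (le_lt_trans px)// ltry.
exists x, (fine (p x)); rewrite fineK//; split=> // v b /mV.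
by move: px; rewrite -{1}(fineK pxfin) lee_fin; lra.
Unshelve. all: by end_near. Qed.

End proximal_minimizer.

(** The bounds squeeze the difference quotient along a basis vector: at step [h] its error is at
    most [|h| * K]. Differentiability is thus derived, not presupposed. *)
Lemma gradient_quadratic_bounds (R : realType) (n : nat)
    (f : 'cV[R]_n -> R) u g k :
  (forall v, f u + dotv g (v - u) <= f v <=
     f u + dotv g (v - u) + k * dotv (v - u) (v - u)) ->
  gradient f u = g.
Proof.
move=> fb; apply/colP => i; rewrite mxE -dotv_delta.
set e := delta_mx _ _.
apply: cvg_lim => //.
apply/cvgrPdist_le => eps eps0.
set K := k * dotv e e.
(* The sign comes from comparing the lower and upper bounds at [e + u]. *)
have K0 : 0 <= K.
  have /andP[h1 h2] := fb (e + u); rewrite /K; move: (le_trans h1 h2).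
  by rewrite addrK lerDl.
have K1 : 0 < K + 1 by lra.
exists (eps / (K + 1)); first by rewrite /= divr_gt0.
move=> h /=; rewrite sub0r normrN ltr_pdivlMr// => heps h0.
have := fb (h *: e + u); rewrite addrK !dotvE.
set F := f (h *: e + u) => /andP[lb ub].
rewrite [X in `|X|](_ : _ = - h^-1 * (F - f u - h * dotv g e)); last first.
  by transitivity (dotv g e - h^-1 * (F - f u)); [|field].
rewrite normrM normrN normfV ler_pdivrMl ?normr_gt0//.
rewrite ger0_norm; last by lra.
apply: (@le_trans _ _ (`|h| * (`|h| * K))).
  rewrite mulrA -expr2 real_normK ?num_real// /K expr2; lra.
rewrite ler_wpM2l//; apply: le_trans (ltW heps).
by rewrite ler_wpM2l//; lra.
Qed.

(** * Moreau envelope: attainment and quadratic bounds *)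

Section moreau_envelope.
Context {R : realType} {n : nat}.
Variables (phi : 'cV[R]_n -> \bar R) (alpha : R).
Hypotheses (alpha_gt0 : 0 < alpha) (phi_ge0 : (forall u, 0 <= phi u)%E)
  (phi_fin : exists u, phi u \is a fin_num)
  (phi_convex : convex_efun phi) (phi_lsc : lower_semicontinuous phi).

Let c : R := (2 * alpha)^-1.
Let E u := fine (moreau_env alpha phi u).

Let c_gt0 : 0 < c.
Proof. by rewrite invr_gt0 mulr_gt0. Qed.

Lemma moreau_env_attained u : exists w a, [/\ phi w = a%:E,
  moreau_env alpha phi u = (a + c * dotv (w - u) (w - u))%:E &
  forall v b, (phi v <= b%:E)%E ->
    a + c * dotv (w - u) (w - u) <= b + c * dotv (v - u) (v - u)].
Proof.
have [w [a [pw wmin]]] :=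
  proximal_min_ex u c_gt0 phi_ge0 phi_fin phi_convex phi_lsc.
exists w, a; split => //; apply/eqP; rewrite eq_le; apply/andP; split.
  by apply: ereal_inf_lbound; exists w => //; rewrite pw enorm_sqr -EFinD.
apply/ereal_infP => _ [v _ <-]; rewrite enorm_sqr -/c.
have := phi_ge0 v; case pv : (phi v) => [b||] // _; last by rewrite addye// leey.
by rewrite -EFinD lee_fin wmin// pv.
Qed.

Lemma moreau_env_fin u : moreau_env alpha phi u \is a fin_num.
Proof. by have [w [a [_ -> _]]] := moreau_env_attained u. Qed.

Lemma moreau_env_le u : (moreau_env alpha phi u <= phi u)%E.
Proof.
apply: ereal_inf_lbound; exists u => //.
by rewrite enorm_sqr subrr dotv0l mulr0 adde0.
Qed.

(* The proximal point [w] of [u] yields the slope [(u - w) / alpha]. *)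
Lemma moreau_env_quadratic_bounds u : exists g, forall v,
  E u + dotv g (v - u) <= E v <=
  E u + dotv g (v - u) + c * dotv (v - u) (v - u).
Proof.
have [w [a [pw envu umin]]] := moreau_env_attained u.
exists ((2 * c) *: (u - w)) => v.
have [w' [a' [pw' envv vmin]]] := moreau_env_attained v.
rewrite /E envu envv /=; apply/andP; split.
  have pa : (phi w <= a%:E)%E by rewrite pw.
  have pa' : (phi w' <= a'%:E)%E by rewrite pw'.
  have := proximal_min_strong (ltW c_gt0) (convex_efun_epi phi_convex) pa
    umin pa'.
  (* Strong minimality of [w], tested at the proximal point [w'] of [v], leaves exactly [c] times
     this square as the gap in the lower bound. *)
  have := dotv_ge0 ((w' - v) + (u - w)).
  rewrite -(pmulr_rge0 _ c_gt0) !dotvE.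
  rewrite (dotvC v u) (dotvC w u) (dotvC w' u) (dotvC w v) (dotvC w' v).
  by rewrite (dotvC w' w); lra.
(* Upper bound: [w] competes in the envelope at [v], and its value there is exactly the right-hand
   side. *)
have := vmin w a; rewrite pw => /(_ (lexx _)); rewrite !dotvE.
by rewrite (dotvC v u) (dotvC w u) (dotvC w v) (dotvC w' v); lra.
Qed.

End moreau_envelope.

(** * Criticality test and sequence lemmas *)

Lemma quadratic_minorant_critical (R : realType) (d : nat)
    (p : 'cV[R]_d -> \bar R) z (K : R) : 0 <= K -> p z \is a fin_num ->
  (forall w, p z - (K * dotv (w - z) (w - z))%:E <= p w)%E ->
  critical_point p z.
Proof.
(* The lower limit is minus the upper limit of the negated quotient, which is at most
   [K * enorm (w - z)] and so below any [e] near [z]. *)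
move=> K0 pz pK; split => //; rewrite /limf_einf oppe_ge0.
apply/lee_addgt0Pr => e e0; rewrite add0e limf_esupE.
apply: ge_ereal_inf; eexists.
  exists [set w | w != z /\ K * enorm (w - z) < e] => //.
  have FF := nbhs_filter z.
  have : K * enorm (w - z) @[w --> z] --> K * 0.
    by apply: cvgMr; exact: cvg_enormB.
  by rewrite mulr0 => /cvgr_lt /(_ e e0); apply: filterS => w we wz; split.
apply/ereal_supP => _ [w [wz we] <-].
have N_gt0 : 0 < enorm (w - z).
  rewrite sqrtr_gt0 lt_neqAle dotv_ge0 andbT eq_sym; apply/eqP => /dotv_eq0.
  by apply/eqP; rewrite subr_eq0.
rewrite dotv0l sube0; have := pK w; rewrite -enorm_sqr -(fineK pz).
case: (p w) => [r||].
- rewrite -!EFinB -EFinM -EFinN !lee_fin => h; rewrite -mulNr ler_pdivrMr//.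
  have := ler_wpM2r (ltW N_gt0) (ltW we).
  by move: h; move: (enorm _) => N; nra.
- by move=> _; rewrite addye// gt0_mulye ?lte_fin ?invr_gt0//= leNye.
- by rewrite -EFinB leeNy_eq.
Qed.

(** Choosing an iterate near [xd] whose outgoing step is already short brings its successor in by
    the triangle inequality. The estimates at limit points involve both iterates at once. *)
Lemma cluster_consecutive (R : realType) (d : nat) (x : nat -> 'cV[R]_d) xd :
  enorm (x k.+1 - x k) @[k --> \oo] --> 0 -> cluster (x @ \oo) xd ->
  forall U, nbhs xd U -> exists k, U (x k) /\ U (x k.+1).
Proof.
move=> dx cx U /nbhs_ballP[e /= e0 eU].
have e2 : 0 < e / 2 by rewrite divr_gt0.
have [_ [[k dk <-] xk]] : [set x k | k in
    [set k | enorm (x k.+1 - x k) < e / 2]] `&` ball xd (e / 2) !=set0.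
  apply: cx; last exact: nbhsx_ballx.
  by rewrite /= nbhs_simpl; apply: filterS (cvgr_lt _ dx _ e2) => k ?; exists k.
exists k; split; apply: eU; first by apply: le_ball xk; lra.
apply: ball_split xk (ball_sym _); apply: dotv_lt_ball => //.
by rewrite -enorm_sqr ltr_pXn2r// nnegrE ?sqrtr_ge0 ?ltW.
Qed.

(** [a] is nonincreasing and bounded below, so it converges; its decrements tend to 0 and dominate
    [l * b k]. *)
Lemma descent_cvg0 (R : realType) (a b : nat -> R) (l : R) : 0 < l ->
  (forall k, 0 <= a k) -> (forall k, 0 <= b k) ->
  (forall k, a k.+1 + l * b k <= a k) -> b k @[k --> \oo] --> 0.
Proof.
move=> l0 a0 b0 ab.
have a_cvg : cvgn a.
  apply: nonincreasing_is_cvgn; last by exists 0 => _ [k _ <-].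
  apply/nonincreasing_seqP => k; apply: le_trans (ab k).
  by rewrite lerDl mulr_ge0 // ltW.
have diff : l^-1 * (a k - a k.+1) @[k --> \oo] --> 0.
  rewrite -(mulr0 l^-1) -(subrr (limn a)); apply: cvgMr; apply: cvgB => //.
  by rewrite (cvg_shiftS a).
apply: squeeze_cvgr (cvg_cst 0) diff; apply: nearW => k; rewrite b0 /=.
by rewrite ler_pdivlMl //; have := ab k; lra.
Qed.

(** * The convex part [Q] and its linearly perturbed minimizers *)

Section composite_objective.
Context {R : realType} {d n : nat}.
Variables (C : set 'cV[R]_d) (z : 'cV[R]_d) (B : 'M[R]_(n, d))
  (phi : 'cV[R]_n -> \bar R) (lambda : R).
Hypotheses (lambda_gt0 : 0 < lambda) (phi_ge0 : (forall u, 0 <= phi u)%E).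

Let l : R := (2 * lambda)^-1.

Definition composite_obj (w : 'cV[R]_d) : \bar R :=
  (((2 * lambda)^-1 * enorm (w - z) ^+ 2)%:E + indicatorf C w
   + phi (B *m w))%E.

Lemma composite_obj_leP w r : (composite_obj w <= r%:E)%E <->
  C w /\ (phi (B *m w) <= (r - l * dotv (w - z) (w - z))%:E)%E.
Proof.
rewrite /composite_obj enorm_sqr -/l /indicatorf.
case: ifPn => [/set_mem Cw|nCw].
  rewrite adde0 EFinB leeBrDl //.
  by split=> [|[]].
have ph : phi (B *m w) != -oo%E by case: (phi _) (phi_ge0 (B *m w)).
rewrite addey// addye// leye_eq; split=> // -[Cw].
by rewrite (mem_set Cw) in nCw.
Qed.

Lemma composite_obj_ge0 w : (0 <= composite_obj w)%E.
Proof.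
have i0 : (0 <= indicatorf C w)%E by rewrite /indicatorf; case: ifP.
by rewrite !adde_ge0// lee_fin mulr_ge0 ?sqr_ge0// invr_ge0 ltW// mulr_gt0.
Qed.

(** The quadratic of the objective is a proximal term centred at [z]. The rest, indicator plus
    [phi (B *m v)] minus [dotv y v], is convex with epigraph [S], so [proximal_min_strong]
    applies. *)
Lemma composite_obj_strong_min y w :
  convex_set (M := 'cV[R]_d) C -> convex_efun phi ->
  argmin (fun v => composite_obj v - (dotv y v)%:E)%E w ->
  exists2 q, composite_obj w = q%:E & forall v r, (composite_obj v <= r%:E)%E ->
    q - dotv y w + l * dotv (v - w) (v - w) <= r - dotv y v.
Proof.
move=> cC /convex_efun_epi cphi [w_fin w_min].
have Qw : composite_obj w = (fine (composite_obj w))%:E.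
  rewrite fineK// ge0_fin_numE ?composite_obj_ge0//.
  rewrite ltey; apply/eqP => Qw_y; move: w_fin.
  by rewrite Qw_y addye// ltxx.
move: (fine _) Qw => q Qw; exists q => // v r Qv.
pose S v a := C v /\ (phi (B *m v) <= (a + dotv y v)%:E)%E.
pose h (v : 'cV[R]_d) : R := l * dotv (v - z) (v - z).
have SP v' r' : S v' (r' - h v' - dotv y v') <-> (composite_obj v' <= r'%:E)%E.
  by rewrite composite_obj_leP /S subrK.
have cS : convex_epi S.
  move=> u v' a b s s01 [Cu pu] [Cv pv]; split.
    have /andP[s0 s1] := s01.
    have := cC u v' (Itv01 s0 s1) (mem_set Cu) (mem_set Cv).
    by move/set_mem.
  rewrite mulmxDr -!scalemxAr; apply: le_trans (cphi _ _ _ _ _ s01 pu pv) _.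
  by rewrite lee_fin !dotvE; lra.
have l0 : 0 <= l by rewrite invr_ge0 ltW// mulr_gt0.
have Sw : S w (q - h w - dotv y w) by rewrite SP Qw.
have := @proximal_min_strong _ _ S l z w (q - h w - dotv y w) l0 cS Sw _ v
  (r - h v - dotv y v).
rewrite SP => /(_ _ Qv); rewrite -/(h w) -/(h v).
suff wmin v' b : S v' b -> q - h w - dotv y w + h w <= b + h v'.
  by move=> /(_ wmin); lra.
have -> : b = (b + h v' + dotv y v') - h v' - dotv y v' by ring.
rewrite SP => Qv'.
have := le_trans (w_min v') (leeB Qv' (lexx (dotv y v')%:E)).
by rewrite Qw -!EFinB lee_fin; lra.
Qed.

End composite_objective.

(** * Vanishing steps and criticality of limit points *)

Theorem theorem3 (R : realType) (d n : nat)
  (C : set 'cV[R]_d) (z : 'cV[R]_d) (B : 'M[R]_(n, d))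
  (phi : 'cV[R]_n -> \bar R) (lambda alpha : R)
  (C_neq0 : C !=set0) (C_closed : closed C)
  (C_convex : convex_set (M := 'cV[R]_d) C)
  (phi_SPF : SPF phi) (phi_convex : convex_efun phi)
  (lambda_gt0 : 0 < lambda) (alpha_gt0 : 0 < alpha) :
  let Q := fun w : 'cV[R]_d =>
    (((2 * lambda)^-1 * enorm (w - z) ^+ 2)%:E + indicatorf C w
     + phi (B *m w))%E in
  let P := fun w : 'cV[R]_d => moreau_env alpha phi (B *m w) in
  forall x y : nat -> 'cV[R]_d,
    dom_subdiff P (x 0%N) ->
    (forall k, y k =
       B^T *m gradient (fun u => fine (moreau_env alpha phi u)) (B *m x k)) ->
    (forall k, argmin (fun w => (Q w - (dotv (y k) w)%:E)%E) (x k.+1)) ->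
    (forall xd, cluster (x @ \oo) xd ->
       critical_point (fun w => (Q w - P w)%E) xd) /\
    (enorm (x k.+1 - x k) @[k --> \oo] --> 0).
Proof.
move=> Q P x y _ yE xE.
have [[[_ phi_fin] phi_lsc] [_ phi_ge0] _] := phi_SPF.
pose l : R := (2 * lambda)^-1; pose c : R := (2 * alpha)^-1.
have l0 : 0 < l by rewrite invr_gt0 mulr_gt0.
have c0 : 0 < c by rewrite invr_gt0 mulr_gt0.
pose p w := fine (P w).
have PE w : P w = (p w)%:E by rewrite fineK// moreau_env_fin.
have [K0 K0_ge0 BK] := dotv_mulmx_le B; pose K := c * K0.
have K_ge0 : 0 <= K by rewrite mulr_ge0 // ltW.
(* Composition with [B] turns the slope [g] into [B^T *m g] and the constant [c] into
   [K = c * K0]. *)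
have p_bounds u : exists g, gradient (fun u => fine (moreau_env alpha phi u))
    (B *m u) = g /\ forall v, p u + dotv (B^T *m g) (v - u) <= p v <=
      p u + dotv (B^T *m g) (v - u) + K * dotv (v - u) (v - u).
  have [g gP] := moreau_env_quadratic_bounds alpha_gt0 phi_ge0 phi_fin
    phi_convex phi_lsc (B *m u).
  exists g; split=> [|v]; first exact: gradient_quadratic_bounds gP.
  have /andP[lb ub] := gP (B *m v); rewrite dotv_mulmx mulmxBr lb.
  apply: le_trans ub _; rewrite lerD2l -mulmxBr -mulrA.
  by rewrite ler_wpM2l // ltW.
have y_bounds k v : p (x k) + dotv (y k) (v - x k) <= p v <=
    p (x k) + dotv (y k) (v - x k) + K * dotv (v - x k) (v - x k).
  by have [g [gE gP]] := p_bounds (x k); rewrite yE gE.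
have QleP w r : (Q w <= r%:E)%E <->
    C w /\ (phi (B *m w) <= (r - l * dotv (w - z) (w - z))%:E)%E.
  exact: composite_obj_leP.
have /choice[q qP] k : exists r, Q (x k.+1) = r%:E /\
    forall v s, (Q v <= s%:E)%E ->
      r - dotv (y k) (x k.+1) + l * dotv (v - x k.+1) (v - x k.+1) <=
      s - dotv (y k) v.
  have [r Qr rmin] := composite_obj_strong_min lambda_gt0 phi_ge0 C_convex
    phi_convex (xE k).
  by exists r.
have Qle k : (Q (x k.+1) <= (q k)%:E)%E by rewrite (qP k).1.
clearbody K l p.
have dx0 : enorm (x k.+1 - x k) @[k --> \oo] --> 0.
  (* [Q (x 0)] may be infinite, so the descent starts at [x 1]; accordingly [q k] is the value of
     [Q] at [x k.+1]. *)
  rewrite -(cvg_shiftS (fun k => enorm (x k.+1 - x k))).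
  have sq0 : dotv (x k.+2 - x k.+1) (x k.+2 - x k.+1) @[k --> \oo] --> 0.
    apply: (@descent_cvg0 _ (fun k => q k - p (x k.+1)) _ l) => //= k.
    - have /QleP[_ h] := Qle k; rewrite subr_ge0 -lee_fin -PE.
      apply: le_trans (moreau_env_le _ _ _) (le_trans h _).
      by rewrite lee_fin gerBl mulr_ge0 ?dotv_ge0 // ltW.
    - exact: dotv_ge0.
    - have := (qP k.+1).2 _ _ (Qle k); have /andP[] := y_bounds k.+1 (x k.+2).
      rewrite -(opprB (x k.+2)) !dotvNl !dotvNr opprK.
      by rewrite (dotvDr (y _)) (dotvNr (y _)); lra.
  have := cvg_comp _ _ sq0 (@sqrt_continuous R _).
  by rewrite sqrtr0.
split=> // xd xd_cluster.
(* Adds the upper bound on [p w], the lower bound on [p (x k.+1)] and the minimality of [x k.+1];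
   all terms in [y k] cancel. *)
have key k w r : (Q w <= r%:E)%E ->
    q k - p (x k.+1) - K * dotv (w - x k) (w - x k) <= r - p w.
  move=> /(qP k).2; have /andP[_] := y_bounds k w.
  have /andP[+ _] := y_bounds k (x k.+1).
  have := mulr_ge0 (ltW l0) (dotv_ge0 (w - x k.+1)).
  by rewrite !(dotvDr (y _)) !(dotvNr (y _)); lra.
have C_xd : C xd.
  apply: contrapT => nC.
  have : nbhs xd (~` C).
    by apply: open_nbhs_nbhs; split=> //; exact: closed_openC.
  move=> /(cluster_consecutive dx0 xd_cluster)[k [_]]; apply.
  by have /QleP[] := Qle k.
have FF := nbhs_filter xd.
(* The limit of [key]: [xd] replaces both [x k] and [x k.+1]. *)
have Qxd_le w r : (Q w <= r%:E)%E ->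
    (Q xd <= (r - p w + p xd + K * dotv (xd - w) (xd - w))%:E)%E.
  move=> Qw; apply/QleP; split => //; rewrite leNgt; apply/negP.
  move=> /lte_EFin_slack[e e0 /phi_lsc[V nV Vlt]].
  (* Three errors of [e / 4] stay below the slack [e]: the [l] quadratic and [p] at [x k.+1], the
     [K] quadratic at [x k]. *)
  have e4 : 0 < e / 4 by lra.
  have [g [_ gP]] := p_bounds xd.
  have quad_near (m : R) v0 : \forall v \near xd,
      m * dotv (v - v0) (v - v0) < m * dotv (xd - v0) (xd - v0) + e / 4.
    have : m * dotv (v - v0) (v - v0) @[v --> xd] -->
        m * dotv (xd - v0) (xd - v0) by apply: cvgMr; exact: cvg_dotvB.
    by move=> /cvgr_lt; apply; rewrite ltrDl.
  (* Upper semicontinuity of [p] at [xd], read off its quadratic upper bound. *)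
  have p_near : \forall v \near xd, p v < p xd + e / 4.
    have : (dotv (B^T *m g) (v - xd) + K * dotv (v - xd) (v - xd))
        @[v --> xd] --> dotv (B^T *m g) (xd - xd) + K * dotv (xd - xd) (xd - xd).
      apply: cvgD; last by apply: cvgMr; exact: cvg_dotvB.
      apply: cvg_dotv; first exact: cvg_cst.
      by apply: cvgB; [exact: cvg_id | exact: cvg_cst].
    rewrite subrr dotvC !dotv0l mulr0 addr0 => /cvgr_lt/(_ _ e4).
    by apply: filterS => v; have /andP[_] := gP v; lra.
  have phi_near : \forall v \near xd, V (B *m v).
    exact: (@continuous_mulmx_cV _ _ _ B xd _ nV).
  have near_xd := filterI (filterI (quad_near (- l) z) (quad_near K w))
    (filterI p_near phi_near).
  have [k [[[_ h1] _] [[h2 _] [h3 /Vlt]]]] :=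
    cluster_consecutive dx0 xd_cluster (near_xd FF FF FF).
  have /QleP[_] := Qle k => h4 /lt_le_trans/(_ h4); rewrite lte_fin.
  have := key k _ _ Qw; rewrite -(opprB (x k) w) dotvNl dotvNr opprK.
  by move: h1 h2 h3; lra.
(* Finiteness follows from the limit inequality tested at [w = x 1]. *)
have Qxd : Q xd = (fine (Q xd))%:E.
  rewrite fineK// ge0_fin_numE; last exact: composite_obj_ge0.
  exact: le_lt_trans (Qxd_le _ _ (Qle 0%N)) (ltry _).
move: (fine _) Qxd => qd Qxd.
apply: (quadratic_minorant_critical K_ge0); first by rewrite Qxd PE -EFinB.
move=> w; rewrite Qxd !PE.
have Qw0 : (0 <= Q w)%E by exact: composite_obj_ge0.
case Qw : (Q w) Qw0 => [r||] // _; last by rewrite addye// leey.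
have := Qxd_le w r; rewrite Qw Qxd => /(_ (lexx _)).
by rewrite -!EFinB !lee_fin -(opprB w) !dotvNl !dotvNr opprK; lra.
Qed.
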